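(* Let $F:\mathbb{R}\to\mathbb{R}$, $F(\theta)=\theta^4/4$, which is bounded below and has a locally Lipschitz continuous derivative. Then for every constant step size $m>0$ there exists $\theta_0\in\mathbb{R}$ such that the gradient descent iterates $\theta_k=\theta_{k-1}-m\dot F(\theta_{k-1})$, $k=1,2,\dots$, diverge ($|\theta_k|\to\infty$), the objective values diverge ($F(\theta_k)\to\infty$), and the absolute values of the derivative diverge ($|\dot F(\theta_k)|\to\infty$).
   Context: $\dot F$ denotes the derivative of $F$. *)

(* Defs.v *)
From mathcomp Require Import all_boot all_order all_algebra.
From mathcomp Require Import boolp classical_sets reals topology normedtype.
From mathcomp Require Import derive.
Set Implicit Arguments.
Unset Strict Implicit.
Unset Printing Implicit Defensive.
Import Order.TTheory GRing.Theory Num.Theory numFieldNormedType.Exports.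
Local Open Scope classical_set_scope.
Local Open Scope ring_scope.

(* Not MathComp-Analysis' [locally [lipschitz f x | x in setT]]: that notation
   localizes at all points (x, y) of R * R, not only at the diagonal ones. *)
Definition locally_lipschitz (R : realType) (f : R -> R) : Prop :=
  forall x : R, exists2 U : set R, nbhs x U & [lipschitz f y | y in U].

Definition gradient_descent (R : realType) (F : R -> R) (m theta0 : R)
    (k : nat) : R :=
  iter k (fun theta => theta - m * derive1 F theta) theta0.

(* Main.v *)
Require Import Defs.
From mathcomp Require Import all_boot all_order all_algebra.
From mathcomp Require Import boolp classical_sets reals topology normedtype.
From mathcomp Require Import derive.
From mathcomp Require Import ring lra.
Import Order.TTheory GRing.Theory Num.Theory numFieldNormedType.Exports.
Local Open Scope classical_set_scope.
Local Open Scope ring_scope.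

(** For the quartic, a gradient step is [x |-> x - m * x ^+ 3], that is,
    multiplication of [x] by [1 - m * x ^+ 2].  Once [m * x ^+ 2 >= 3] this
    factor is at most [-2]: the step overshoots the minimizer at [0] and at
    least doubles the distance to it ([cubic_step_doubles]).  The condition
    on [m * x ^+ 2] then persists, so the iterates grow geometrically
    ([gradient_descent_growth]).  Such starting points exist however small
    the step size is, because the curvature of the quartic is unbounded.
    For [`|x| >= 2] both [x ^+ 4 / 4] and [`|x ^+ 3|] dominate [`|x|], so
    the objective and its derivative diverge with the iterates.

    The derivative [x ^+ 3] is locally Lipschitz because
    [y ^+ 3 - z ^+ 3 = (y - z) * (y ^+ 2 + y * z + z ^+ 2)], whose second
    factor is bounded on bounded sets. *)

Lemma is_derive_quartic (R : realType) (F : R -> R)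
    (hF : forall theta : R, F theta = theta ^+ 4 / 4) (x : R) :
  is_derive x 1 F (x ^+ 3).
Proof.
have -> : F = 4^-1 \*: (fun y => y ^+ 4).
  by apply/funext => y; rewrite hF /= mulrC.
have d : is_derive x 1 (fun y : R => y ^+ 4) (x ^+ 3 *+ 4).
  by apply: is_derive_eq; rewrite /GRing.scale /=; ring.
apply: is_derive_eq.
by rewrite /GRing.scale /=; field.
Qed.

Lemma derive1_quartic (R : realType) (F : R -> R)
    (hF : forall theta : R, F theta = theta ^+ 4 / 4) :
  derive1 F = (fun x => x ^+ 3).
Proof.
apply/funext => x; rewrite derive1E.
by have d := is_derive_quartic R F hF x; exact: derive_val.
Qed.

Lemma cube_lipschitz_bounded (R : realDomainType) (b y z : R) :
  `|y| <= b -> `|z| <= b -> `|y ^+ 3 - z ^+ 3| <= 3 * b ^+ 2 * `|y - z|.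
Proof.
move=> hy hz.
have -> : y ^+ 3 - z ^+ 3 = (y ^+ 2 + y * z + z ^+ 2) * (y - z) by ring.
rewrite normrM ler_wpM2r //.
apply: le_trans (ler_normD _ _) _.
apply: le_trans (lerD (ler_normD _ _) (lexx _)) _.
rewrite !normrX normrM.
have -> : 3 * b ^+ 2 = b ^+ 2 + b * b + b ^+ 2 by ring.
by rewrite !expr2; apply: lerD; [apply: lerD|]; rewrite ler_pM.
Qed.

Lemma locally_lipschitz_cube (R : realType) :
  locally_lipschitz (fun x : R => x ^+ 3).
Proof.
move=> x; exists (ball x 1); first exact: nbhsx_ballx.
have bound (y : R) : ball x 1 y -> `|y| <= `|x| + 1.
  rewrite /ball /= => xy.
  have -> : y = x - (x - y) by ring.
  by rewrite (le_trans (ler_normB _ _)) // lerD2l ltW.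
have proper : ProperFilter (globally (ball x 1 `*` ball x 1)).
  by apply: (@globally_properfilter _ _ (x, x)); split; exact: ballxx.
apply: (@klipschitzW _ _ _ (3 * (`|x| + 1) ^+ 2)).
move=> -[y z] /= [/bound hy /bound hz].
exact: cube_lipschitz_bounded.
Qed.

(** The step multiplies [x] by [1 - m * x ^+ 2 <= -2]. *)
Lemma cubic_step_doubles (R : realType) (m x : R) :
  3 <= m * x ^+ 2 -> 2 * `|x| <= `|x - m * x ^+ 3|.
Proof.
move=> hx.
have -> : x - m * x ^+ 3 = - ((m * x ^+ 2 - 1) * x) by ring.
rewrite normrN normrM ler_wpM2r // ger0_norm; lra.
Qed.

Lemma gradient_descent_growth (R : realType) (F : R -> R)
    (hF : forall theta : R, F theta = theta ^+ 4 / 4) (m x : R) (k : nat) :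
  0 < m -> 3 <= m * x ^+ 2 ->
  2 ^+ k * `|x| <= `|gradient_descent F m x k|.
Proof.
move=> m0 hx; elim: k => [|k IH]; first by rewrite mul1r.
rewrite /gradient_descent iterS -/(gradient_descent F m x k).
rewrite derive1_quartic //.
set y := gradient_descent F m x k in IH *.
have xy : `|x| <= `|y|.
  by apply: le_trans IH; rewrite ler_peMl // exprn_ege1 // ler1n.
(* The iterates only move away from the origin, so the doubling condition
   holds again at the current one. *)
have hy : 3 <= m * y ^+ 2.
  apply: le_trans hx _; rewrite ler_wpM2l ?(ltW m0) //.
  rewrite -(real_normK (num_real x)) -(real_normK (num_real y)).
  by rewrite lerXn2r ?nnegrE.
apply: le_trans (cubic_step_doubles R m y hy).
by rewrite exprS -mulrA ler_wpM2l.
Qed.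

Theorem proposition3p3 (R : realType) (F : R -> R)
    (hF : forall theta : R, F theta = theta ^+ 4 / 4) :
  [/\ has_lbound (range F),
      (forall theta : R, derivable F theta 1),
      locally_lipschitz (derive1 F)
    & forall m : R, 0 < m ->
      exists theta0 : R,
        let theta := gradient_descent F m theta0 in
        [/\ (fun k : nat => `|theta k|) @ \oo --> +oo,
            (fun k : nat => F (theta k)) @ \oo --> +oo
          & (fun k : nat => `|derive1 F (theta k)|) @ \oo --> +oo]].
Proof.
split.
- exists 0 => _ [x _ <-]; rewrite hF.
  by rewrite divr_ge0 // exprn_even_ge0.
- by move=> x; have d := is_derive_quartic R F hF x; exact: ex_derive.
- by rewrite derive1_quartic //; exact: locally_lipschitz_cube.
move=> m m0.
(* The summand [3 / m] makes [m * theta0 ^+ 2 >= 3]; the summand [2] keeps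
   the iterates where [`|x| <= x ^+ 4 / 4]. *)
pose theta0 : R := 2 + 3 / m; exists theta0 => theta.
have q0 : 0 < 3 / m by rewrite divr_gt0.
have theta0_ge2 : 2 <= theta0 by rewrite lerDl ltW.
have htheta0 : 3 <= m * theta0 ^+ 2.
  have mq : m * (3 / m) = 3 by field; rewrite gt_eqF.
  have -> : m * theta0 ^+ 2 = m * 4 + 4 * (m * (3 / m)) + m * (3 / m) ^+ 2.
    by rewrite /theta0; ring.
  rewrite mq; have := mulr_ge0 (ltW m0) (sqr_ge0 (3 / m)); lra.
have growth k : 2 ^+ k * 2 <= `|theta k|.
  apply: le_trans (gradient_descent_growth R F hF m theta0 k m0 htheta0).
  by rewrite ler_wpM2l ?exprn_ge0 // ger0_norm //; lra.
have ge2 k : 2 <= `|theta k|.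
  by apply: le_trans (growth k); rewrite ler_peMl // exprn_ege1 // ler1n.
have theta_oo : (fun k : nat => `|theta k|) @ \oo --> +oo.
  apply: ger_cvgy cvgr_idn; apply: nearW => k.
  apply: le_trans (growth k).
  rewrite -natrX -natrM ler_nat (leq_trans (ltnW (ltn_expl k (ltnSn 1)))) //.
  by rewrite leq_pmulr.
split=> //; apply: ger_cvgy theta_oo; apply: nearW => k; have := ge2 k.
- rewrite hF.
  have -> : theta k ^+ 4 = `|theta k| ^+ 4.
    by rewrite -normrX ger0_norm // exprn_even_ge0.
  move: `|theta k| => t t2.
  have t3 : 2 ^+ 3 <= t ^+ 3 by rewrite lerXn2r // nnegrE; lra.
  rewrite exprSr; nra.
- rewrite derive1_quartic // normrX => t2.
  by rewrite ler_eXnr //; lra.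
Qed.
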